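(* Let $C_1$ and $C_2$ be two independent Cauchy random variables, where $C_i$ has location parameter $b_i$ and scale parameter $a_i$, $i=1,2$. Then the random variable $$U=\frac{C_1+C_2}{1-C_1C_2}$$ is still Cauchy distributed, with scale parameter $$a_U=\frac{(a_1+a_2)(1+a_1a_2-b_1b_2)+(b_1+b_2)(a_1b_2+a_2b_1)}{(1+a_1a_2-b_1b_2)^2+(a_1b_2+a_2b_1)^2}$$ and position (location) parameter $$b_U=\frac{(a_1+a_2)(a_1b_2+a_2b_1)-(b_1+b_2)(1+a_1a_2-b_1b_2)}{(1+a_1a_2-b_1b_2)^2+(a_1b_2+a_2b_1)^2}.$$
   Context: A Cauchy random variable with scale parameter $a>0$ and location (position) parameter $b\in\mathbb{R}$ has density $\frac{1}{\pi}\frac{a}{(x-b)^2+a^2}$, $x\in\mathbb{R}$.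
   Formalization: The printed location parameter b_U has the wrong sign (for a_1=a_2=b_1=b_2=1 the true location is -2/5, the printed one 2/5); the formal theorem proves the claim with location -b_U, the scale a_U being unchanged. *)

(* Defs.v *)
From HB Require Import structures.
From mathcomp Require Import all_boot all_order all_algebra.
From mathcomp Require Import all_classical all_reals all_analysis.

Set Implicit Arguments.
Unset Strict Implicit.
Unset Printing Implicit Defensive.

Import Order.TTheory GRing.Theory Num.Theory.
Import numFieldNormedType.Exports.

Local Open Scope classical_set_scope.
Local Open Scope ring_scope.

Definition cauchy_pdf {R : realType} (a b x : R) : R :=
  pi^-1 * (a / ((x - b) ^+ 2 + a ^+ 2)).

(* Stated for a bare function, so that measurability of [X] is part of the
   claim; [a] is the scale and [b] the location. *)
Definition cauchy_distributed {d : measure_display} {T : measurableType d}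
    {R : realType} (P : probability T R) (X : T -> R) (a b : R) : Prop :=
  [/\ 0 < a, measurable_fun [set: T] X &
      forall A : set R, measurable A ->
        pushforward P X A =
          (\int[@lebesgue_measure R]_(x in A) (cauchy_pdf a b x)%:E)%E].

Definition independent_RV2 {d : measure_display} {T : measurableType d}
    {R : realType} (P : probability T R) (X Y : {RV P >-> R}) : Prop :=
  forall A B : set R, measurable A -> measurable B ->
    (P (X @^-1` A `&` Y @^-1` B) = P (X @^-1` A) * P (Y @^-1` B))%E.

(* Main.v *)
(* With x = tan t, the measure dx / (1 + x^2) is the Lebesgue measure dt modulo
   pi, hence it is invariant under the rotations y |-> (x + y) / (1 - x y).
   Rewriting the density of C2 relative to this measure gives the density of
   (x + C2) / (1 - x C2) for each fixed x, with no change of variables on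
   the line. By independence and Tonelli, the density of U at u is the integral
   over x of this conditional density against the density of C1: a rational
   function whose denominator is a product of two quadratics, which has an
   explicit antiderivative by partial fractions (the case where the two
   quadratics coincide being apart). *)
Require Import Defs.
From HB Require Import structures.
From mathcomp Require Import all_boot all_order all_algebra.
From mathcomp Require Import all_classical all_reals all_analysis.
From mathcomp Require Import measurable_realfun ring lra.

Set Implicit Arguments.
Unset Strict Implicit.
Unset Printing Implicit Defensive.

Import Order.TTheory GRing.Theory Num.Theory.
Import numFieldNormedType.Exports.

Local Open Scope classical_set_scope.
Local Open Scope ring_scope.

(** * Measurability of inverses and integration against a density *)

Lemma measurable_funVr d (T : measurableType d) (R : realType) (D : set T)
    (f : T -> R) :
  measurable_fun D f -> measurable_fun D (fun x => (f x)^-1).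
Proof.
move=> mf.
(* [powR] at exponent -1 agrees with the inverse on nonnegative reals, hence the detour through the
   square; where [f x = 0] both sides are 0. *)
have -> : (fun x => (f x)^-1) = (fun x => f x * ((f x ^+ 2) `^ (-1))).
  apply/funext => x; rewrite powR_inv1 ?sqr_ge0//.
  have [->|fx0] := eqVneq (f x) 0; first by rewrite invr0 mul0r.
  by rewrite expr2 invfM mulrA divff// mul1r.
apply: measurable_funM => //.
have := measurableT_comp (measurable_powR (-1)) (measurable_funX 2 mf).
exact.
Qed.

Section density.
Import HBNNSimple.

(** Monotone convergence on both sides reduces [f] to simple functions. It serves twice: for
    Lebesgue measure relative to dx / (1 + x^2), and for the law of [C1] relative to Lebesgue
    measure. *)
Lemma ge0_integral_density d (T : measurableType d) (R : realType)
    (mu nu : {measure set T -> \bar R}) (w : T -> R) (f : T -> \bar R) :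
  measurable_fun [set: T] w -> (forall x, 0 <= w x) ->
  (forall A, measurable A -> nu A = (\int[mu]_(x in A) (w x)%:E)%E) ->
  measurable_fun [set: T] f -> (forall x, (0 <= f x)%E) ->
  (\int[nu]_x f x = \int[mu]_x (f x * (w x)%:E))%E.
Proof.
move=> mw w0 nuE mf f0.
pose h := nnsfun_approx measurableT mf.
have hf x : f x = limn (EFin \o h ^~ x).
  by apply/esym/cvg_lim => //; exact: cvg_nnsfun_approx.
have mwE : measurable_fun [set: T] (EFin \o w) by exact/measurable_EFinP.
have -> : (\int[nu]_x f x = limn (fun n => \int[nu]_x (EFin \o h n) x))%E.
  under eq_integral do rewrite hf.
  apply: monotone_convergence => //.
  - by move=> n; exact/measurable_EFinP/measurable_funP.
  - by move=> n x _; rewrite lee_fin.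
  - by move=> x _ a b ab; rewrite lee_fin; exact/lefP/nd_nnsfun_approx.
have -> : (\int[mu]_x (f x * (w x)%:E) =
    limn (fun n => \int[mu]_x ((h n x)%:E * (w x)%:E)))%E.
  have fw x : (f x * (w x)%:E = limn (fun n => (h n x)%:E * (w x)%:E))%E.
    apply/esym/cvg_lim => //; apply: cvgeZr => //.
    exact: cvg_nnsfun_approx.
  under eq_integral do rewrite fw.
  apply: monotone_convergence => //.
  - move=> n; apply: emeasurable_funM => //.
    exact/measurable_EFinP/measurable_funP.
  - by move=> n x _; rewrite mule_ge0 ?lee_fin.
  - move=> x _ a b ab; rewrite lee_wpmul2r ?lee_fin//.
    exact/lefP/nd_nnsfun_approx.
congr (limn _); apply/funext => n.
transitivity (\int[nu]_x
   (\sum_(y \in range (h n)) (y * \1_(h n @^-1` [set y]) x)%:E))%E.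
  by apply: eq_integral => t _; rewrite /= fimfunE -fsumEFin.
have indich r : measurable_fun [set: T]
    (fun x => (r * \1_(h n @^-1` [set r]) x)%:E).
  by apply/measurable_EFinP; exact: measurable_funM.
rewrite ge0_integral_fsum//; last by move=> m y _; exact: nnfun_muleindic_ge0.
transitivity (\int[mu]_x (\sum_(y \in range (h n))
    (y * \1_(h n @^-1` [set y]) x)%:E * (w x)%:E))%E; last first.
  apply: eq_integral => x _.
  rewrite -ge0_mule_fsuml => [|y]; last exact: nnfun_muleindic_ge0.
  by rewrite fsumEFin // -(fimfunE _ x).
rewrite ge0_integral_fsum//; last 2 first.
- by move=> y; exact: emeasurable_funM.
- move=> m y _; apply: mule_ge0; last by rewrite lee_fin.
  exact: nnfun_muleindic_ge0.
(* On a single level set of [h n] the claim is the density hypothesis [nuE], up to a constant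
   factor. *)
apply: eq_fsbigr => r; rewrite inE => -[t _ <-].
rewrite integralZl_indic_nnsfun// integral_indic// setIT nuE//.
under [RHS]eq_integral do rewrite EFinM -muleA.
rewrite ge0_integralZl//; last 3 first.
- by apply: emeasurable_funM mwE; exact/measurable_EFinP.
- by move=> x _; rewrite mule_ge0 ?lee_fin.
- by rewrite lee_fin.
congr (_ * _)%E; rewrite integral_mkcond; apply: eq_integral => x _.
by rewrite epatch_indic muleC.
Qed.

End density.

(** * Integration over the whole line from an antiderivative *)

Lemma ge0_FTC2_setT (R : realType) (f F : R -> R) (l l' : R) :
  (forall x, 0 <= f x) -> continuous f ->
  (forall x : R, is_derive x 1 F (f x)) ->
  F x @[x --> +oo] --> l -> F x @[x --> -oo] --> l' ->
  (\int[@lebesgue_measure R]_x (f x)%:E = (l - l')%:E)%E.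
Proof.
move=> f0 cf dF Fl Fl'.
have cF : continuous F.
  by move=> x; apply/differentiable_continuous/derivable1_diffP; case: (dF x).
have mf : measurable_fun [set: R] f by exact: continuous_measurable_fun.
(* The line is the complement of the empty interval []0, 0]], that is, the union of []-oo, 0]] and
   []0, +oo[]. *)
rewrite -setC0 -(set_itvoc0 0%R) setCitv/= ge0_integral_setU//=; first last.
- rewrite disj_set2E; apply/eqP; rewrite -subset0 => x []/= /[!in_itv]/=.
  by rewrite leNgt andbT => /negP.
- by move=> x _; rewrite lee_fin.
- by apply/measurable_EFinP; exact: measurable_funTS.
rewrite integral_itv_obnd_cbnd; last first.
  by apply/measurable_EFinP/measurable_funTS.
rewrite (@ge0_continuous_FTC2y _ f F 0 l)//; last 3 first.
- exact: continuous_subspaceT.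
- by apply: cvg_at_right_filter; exact: cF.
- by move=> x _; rewrite derive1E derive_val.
(* With 0 written as - 0, the substitution x |-> - x carries the left half-line to the right one,
   where [- F (- x)] is an antiderivative. *)
rewrite -[in X in `]-oo, X]]oppr0.
rewrite ge0_integration_by_substitutionNy//; last first.
  exact: continuous_subspaceT.
have dFN (x : R) : is_derive x 1 (fun x => - F (- x)) (f (- x)).
  have dN := is_deriveN (is_derive_id x 1).
  have := is_deriveN (is_derive1_comp (dF (- x)) dN).
  by rewrite mulrN1 opprK.
have cfN : continuous (f \o -%R).
  by move=> x; apply: continuous_comp; [exact: opp_continuous|exact: cf].
rewrite (@ge0_continuous_FTC2y _ (f \o -%R) (fun x => - F (- x)) 0 (- l'))//=.
- by rewrite oppr0 -!EFinB -EFinD; congr EFin; ring.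
- exact: continuous_subspaceT.
- by apply: cvgN; exact/cvgNy_compNP.
- apply: cvg_at_right_filter; apply: cvgN.
  by apply: (@continuous_comp _ _ _ -%R F 0); [exact: opp_continuous|exact: cF].
- by move=> x _; rewrite derive1E derive_val.
Qed.

(** * Derivatives and limits at infinity around the quadratic [cauchy_den] *)

Lemma cvg_comp_inv_y (R : realType) (f : R -> R) :
  {for 0, continuous f} -> f x^-1 @[x --> +oo] --> f 0.
Proof.
move=> cf; apply: (cvg_comp (fun x : R => x^-1) f); last exact: cf.
apply/gtr0_cvgV0; last exact: cvg_id.
exact: nbhs_pinfty_gt.
Qed.

(** This is |x - z|^2 for z = b + i a: the monic quadratic with roots b + i a and b - i a. *)
Definition cauchy_den (R : realType) (a b x : R) : R := (x - b) ^+ 2 + a ^+ 2.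

Section cauchy_den.
Context {R : realType}.
Implicit Types a b x : R.

Lemma cauchy_den_gt0 a b x : 0 < a -> 0 < cauchy_den a b x.
Proof. by move=> a0; rewrite ltr_wpDl ?sqr_ge0// exprn_gt0. Qed.

Lemma is_derive_cauchy_den a b x :
  is_derive x 1 (cauchy_den a b) (2 * (x - b)).
Proof.
rewrite /cauchy_den; apply: is_derive_eq.
by rewrite /GRing.scale/=; ring.
Qed.

Lemma continuous_cauchy_den a b : continuous (cauchy_den a b).
Proof.
move=> x; apply/differentiable_continuous/derivable1_diffP.
by case: (is_derive_cauchy_den a b x).
Qed.

Lemma is_derive_ln_cauchy_den a b x : 0 < a ->
  is_derive x 1 (fun x => ln (cauchy_den a b x))
    (2 * (x - b) / cauchy_den a b x).
Proof.
move=> a0; have q0 := cauchy_den_gt0 b x a0.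
have := is_derive1_comp (is_derive1_ln q0) (is_derive_cauchy_den a b x).
by rewrite mulrC.
Qed.

Lemma is_derive_atan_affine a b x : 0 < a ->
  is_derive x 1 (fun x => atan ((x - b) / a)) (a / cauchy_den a b x).
Proof.
move=> a0; have q0 := cauchy_den_gt0 b x a0.
have d1 : is_derive x 1 (fun x => (x - b) / a) a^-1.
  by apply: is_derive_eq; rewrite /GRing.scale/=; ring.
have := @is_derive1_comp _ _ (fun x => (x - b) / a) _ _ _
  (is_derive1_atan ((x - b) / a)) d1.
move=> /is_derive_eq; apply; rewrite /cauchy_den.
field.
by rewrite !gt_eqF.
Qed.

Lemma cvgy_atan_affine a b : 0 < a ->
  atan ((x - b) / a) @[x --> +oo] --> pi / 2.
Proof.
move=> a0; apply: (cvg_comp (fun x => (x - b) / a)); last exact: cvgy_atan.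
apply: gt0_cvgMly; first by rewrite invr_gt0.
exact: cvg_addrr.
Qed.

Lemma cvgNy_atan_affine a b : 0 < a ->
  atan ((x - b) / a) @[x --> -oo] --> - (pi / 2).
Proof.
move=> a0; apply/cvgNy_compNP.
have -> : (fun x => atan ((x - b) / a)) \o -%R =
    (fun x => - atan ((x - - b) / a)).
  by apply/funext => x /=; rewrite -atanN -mulNr opprD !opprK.
by apply: cvgN; exact: cvgy_atan_affine.
Qed.

(** Each logarithm diverges, so the difference is read as the logarithm of a quotient. In the
    variable t = 1 / x this quotient is [g t], continuous at 0 with value 1. *)
Lemma cvgy_ln_cauchy_denB a1 b1 a b : 0 < a1 -> 0 < a ->
  ln (cauchy_den a1 b1 x) - ln (cauchy_den a b x) @[x --> +oo] --> 0.
Proof.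
move=> a10 a0.
pose g t := ((1 - b1 * t) ^+ 2 + (a1 * t) ^+ 2) /
            ((1 - b * t) ^+ 2 + (a * t) ^+ 2).
have g1 : g 0 = 1 by rewrite /g !mulr0 subr0 expr0n/= addr0 expr1n divr1.
have cg : {for 0, continuous g}.
  have cp a' b' :
      {for 0, continuous (fun t : R => (1 - b' * t) ^+ 2 + (a' * t) ^+ 2)}.
    by apply/differentiable_continuous/derivable1_diffP; exact: ex_derive.
  apply: continuousM; first exact: cp.
  apply: continuousV; last exact: cp.
  by rewrite !mulr0 subr0 expr0n/= addr0 expr1n oner_neq0.
have := @cvg_comp_inv_y _ (@ln R \o g).
rewrite /= g1 ln1.
have : {for 0, continuous (@ln R \o g)}.
  by apply: continuous_comp => //; rewrite g1; exact: continuous_ln.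
move=> /[swap] /[apply]; apply: cvg_trans; apply: near_eq_cvg.
near=> x.
have x0 : 0 < x by near: x; exact: nbhs_pinfty_gt.
have qx a' b' :
    cauchy_den a' b' x = x ^+ 2 * ((1 - b' / x) ^+ 2 + (a' / x) ^+ 2).
  by rewrite /cauchy_den; field; rewrite gt_eqF.
rewrite -ln_div ?posrE ?cauchy_den_gt0//; congr ln.
rewrite !qx /g.
rewrite invfM mulrACA divff ?mul1r// expf_neq0// gt_eqF//.
Unshelve. all: by end_near.
Qed.

End cauchy_den.

Section cauchy_den_integral.
Context {R : realType}.
Implicit Types a b x : R.

Lemma cvgNy_ln_cauchy_denB a1 b1 a b : 0 < a1 -> 0 < a ->
  ln (cauchy_den a1 b1 x) - ln (cauchy_den a b x) @[x --> -oo] --> 0.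
Proof.
move=> a10 a0; apply/cvgNy_compNP.
have qN a' b' x : cauchy_den a' b' (- x) = cauchy_den a' (- b') x.
  by rewrite /cauchy_den; ring.
rewrite (_ : _ \o _ = fun x =>
  ln (cauchy_den a1 (- b1) x) - ln (cauchy_den a (- b) x)).
  exact: cvgy_ln_cauchy_denB.
by apply/funext => x /=; rewrite !qN.
Qed.

Lemma cvgy_affine_div_cauchy_den (c e : R) a b : 0 < a ->
  (c * x + e) / cauchy_den a b x @[x --> +oo] --> 0.
Proof.
move=> a0.
(* The fraction in the variable t = 1 / x, numerator and denominator both multiplied by t^2. *)
pose g t := (c * t + e * t ^+ 2) / ((1 - b * t) ^+ 2 + (a * t) ^+ 2).
have g0 : g 0 = 0 by rewrite /g !mulr0 expr0n/= mulr0 addr0 mul0r.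
have cg : {for 0, continuous g}.
  apply: continuousM.
    by apply/differentiable_continuous/derivable1_diffP; exact: ex_derive.
  apply: continuousV.
    by rewrite !mulr0 subr0 expr0n/= addr0 expr1n oner_neq0.
  by apply/differentiable_continuous/derivable1_diffP; exact: ex_derive.
have := cvg_comp_inv_y cg.
rewrite g0; apply: cvg_trans; apply: near_eq_cvg.
near=> x.
have x0 : 0 < x by near: x; exact: nbhs_pinfty_gt.
have q0 := cauchy_den_gt0 b x a0.
have qx : cauchy_den a b x = x ^+ 2 * ((1 - b / x) ^+ 2 + (a / x) ^+ 2).
  by rewrite /cauchy_den; field; rewrite gt_eqF.
have q'0 : (1 - b / x) ^+ 2 + (a / x) ^+ 2 != 0.
  by move: q0; rewrite qx; apply: contraTneq => ->; rewrite mulr0 ltxx.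
rewrite /g qx; move: q'0; set q' := _ ^+ 2 + _ ^+ 2 => q'0.
by field; rewrite q'0 gt_eqF.
Unshelve. all: by end_near.
Qed.

Lemma cvgNy_affine_div_cauchy_den (c e : R) a b : 0 < a ->
  (c * x + e) / cauchy_den a b x @[x --> -oo] --> 0.
Proof.
move=> a0; apply/cvgNy_compNP.
rewrite (_ : _ \o _ = fun x => ((- c) * x + e) / cauchy_den a (- b) x).
  exact: cvgy_affine_div_cauchy_den.
by apply/funext => x /=; congr (_ / _); rewrite /cauchy_den; ring.
Qed.

(** * The integral of 1 + x^2 over a product of two quadratics *)

Let N x := 1 + x ^+ 2.

Let N_ge0 x : 0 <= N x.
Proof. by rewrite addr_ge0// sqr_ge0. Qed.

Let cN : continuous N.
Proof.
by move=> x; apply/differentiable_continuous/derivable1_diffP; exact: ex_derive.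
Qed.

Let integrand_ge0 a1 b1 a b x : 0 < a1 -> 0 < a ->
  0 <= N x / (cauchy_den a1 b1 x * cauchy_den a b x).
Proof. by move=> ? ?; rewrite divr_ge0// mulr_ge0// ltW// cauchy_den_gt0. Qed.

Let continuous_integrand a1 b1 a b : 0 < a1 -> 0 < a ->
  continuous (fun x => N x / (cauchy_den a1 b1 x * cauchy_den a b x)).
Proof.
move=> a10 a0 x; apply: continuousM; first exact: cN.
apply: continuousV; first by rewrite gt_eqF// mulr_gt0// cauchy_den_gt0.
by apply: continuousM; exact: continuous_cauchy_den.
Qed.

Let integral_partial_fractions_neq a1 b1 a b : 0 < a1 -> 0 < a ->
  (b1 - b) ^+ 2 + (a1 - a) ^+ 2 != 0 ->
  (\int[@lebesgue_measure R]_x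
     (N x / (cauchy_den a1 b1 x * cauchy_den a b x))%:E =
   (pi / a1 * (1 + (2 * b * (b1 - b) + (1 + b ^+ 2 - a ^+ 2) * (a + a1) / a) /
                ((b1 - b) ^+ 2 + (a1 + a) ^+ 2)))%:E)%E.
Proof.
move=> a10 a0 D0; pose s := b1 - b.
(* [D] is the resultant of the two quadratics, |z1 - z|^2 |z1 - conj z|^2 with z1 = b1 + i a1 and z
   = b + i a; it is nonzero since z1 and z differ. *)
pose D := (s ^+ 2 + (a1 - a) ^+ 2) * (s ^+ 2 + (a1 + a) ^+ 2).
have D'0 : s ^+ 2 + (a1 + a) ^+ 2 != 0.
  by rewrite gt_eqF// ltr_wpDl ?sqr_ge0// exprn_gt0// addr_gt0.
have DN0 : D != 0 by rewrite mulf_neq0.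
(* Coefficients of the partial fractions, read off the residue of the
   integrand at b1 + i a1 (for A and B) and at b + i a (for C). *)
pose A := (2 * b1 * (s ^+ 2 + a ^+ 2 - a1 ^+ 2) -
           2 * s * (1 + b1 ^+ 2 - a1 ^+ 2)) / D.
pose B := ((1 + b1 ^+ 2 - a1 ^+ 2) * (s ^+ 2 + a ^+ 2 - a1 ^+ 2) +
           4 * a1 ^+ 2 * b1 * s) / D.
pose C := ((1 + b ^+ 2 - a ^+ 2) * (s ^+ 2 + a1 ^+ 2 - a ^+ 2) -
           4 * a ^+ 2 * b * s) / D.
have NE x : N x = (A * (x - b1) + B) * cauchy_den a b x +
                  (- A * (x - b) + C) * cauchy_den a1 b1 x.
  apply: (mulfI DN0); rewrite /A /B /C /N /cauchy_den.
  move: DN0; rewrite /D /s => DN0; field.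
  by move: DN0; rewrite mulf_eq0 negb_or andbC.
(* The logarithms have opposite coefficients, so their total contribution vanishes at both ends;
   each arctangent increases by pi, and the integral is pi (B / a1 + C / a). *)
pose F x := A / 2 * (ln (cauchy_den a1 b1 x) - ln (cauchy_den a b x)) +
  (B / a1 * atan ((x - b1) / a1) + C / a * atan ((x - b) / a)).
have dF x : is_derive x 1 F (N x / (cauchy_den a1 b1 x * cauchy_den a b x)).
  have dl1 := is_derive_ln_cauchy_den b1 x a10.
  have dl := is_derive_ln_cauchy_den b x a0.
  have da1 := is_derive_atan_affine b1 x a10.
  have da := is_derive_atan_affine b x a0.
  apply: is_derive_eq; rewrite NE /GRing.scale/=.
  have := cauchy_den_gt0 b1 x a10; have := cauchy_den_gt0 b x a0.
  move: (cauchy_den a b x) (cauchy_den a1 b1 x) => q q1 q0 q10.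
  by field; rewrite !gt_eqF.
have Fy : F x @[x --> +oo] -->
    A / 2 * 0 + (B / a1 * (pi / 2) + C / a * (pi / 2)).
  apply: cvgD; first by apply: cvgMl_tmp; exact: cvgy_ln_cauchy_denB.
  by apply: cvgD; apply: cvgMl_tmp; exact: cvgy_atan_affine.
have FNy : F x @[x --> -oo] -->
    A / 2 * 0 + (B / a1 * - (pi / 2) + C / a * - (pi / 2)).
  apply: cvgD; first by apply: cvgMl_tmp; exact: cvgNy_ln_cauchy_denB.
  by apply: cvgD; apply: cvgMl_tmp; exact: cvgNy_atan_affine.
rewrite (ge0_FTC2_setT _ _ dF Fy FNy); last 2 first.
- by move=> x; exact: integrand_ge0.
- exact: continuous_integrand.
congr EFin; rewrite /B /C; move: D'0 D0; rewrite /D /s => D'0 D0.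
by field; rewrite D'0 D0 !gt_eqF.
Qed.

Let integral_partial_fractions_eq a b : 0 < a ->
  (\int[@lebesgue_measure R]_x
     (N x / (cauchy_den a b x * cauchy_den a b x))%:E =
   (pi / a * (1 + (1 + b ^+ 2 - a ^+ 2) / (2 * a ^+ 2)))%:E)%E.
Proof.
move=> a0.
(* With q the quadratic, 1 + x^2 = q + 2 b (x - b) + 2 a^2 K. Dividing by q^2, the three terms
   integrate to an arctangent, to - b / q, and to K (x - b) / q plus K times the same arctangent. *)
pose K := (1 + b ^+ 2 - a ^+ 2) / (2 * a ^+ 2).
pose F x := (1 + K) / a * atan ((x - b) / a) +
  (K * x - (K + 1) * b) / cauchy_den a b x.
have dF x : is_derive x 1 F (N x / (cauchy_den a b x * cauchy_den a b x)).
  have dq := is_derive_cauchy_den a b x.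
  have q0 := cauchy_den_gt0 b x a0.
  have dqV := is_deriveV (lt0r_neq0 q0) dq.
  have da := is_derive_atan_affine b x a0.
  apply: is_derive_eq; rewrite /GRing.scale/=.
  move: q0; rewrite /N /K /cauchy_den => q0.
  field.
  by rewrite !gt_eqF.
have Fy : F x @[x --> +oo] --> (1 + K) / a * (pi / 2) + 0.
  apply: cvgD; first by apply: cvgMl_tmp; exact: cvgy_atan_affine.
  exact: cvgy_affine_div_cauchy_den.
have FNy : F x @[x --> -oo] --> (1 + K) / a * - (pi / 2) + 0.
  apply: cvgD; first by apply: cvgMl_tmp; exact: cvgNy_atan_affine.
  exact: cvgNy_affine_div_cauchy_den.
rewrite (ge0_FTC2_setT _ _ dF Fy FNy); last 2 first.
- by move=> x; exact: integrand_ge0.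
- exact: continuous_integrand.
by congr EFin; rewrite /K; field; rewrite gt_eqF.
Qed.

(** With q = [cauchy_den a b x], 1 + x^2 = q + 2 b (x - b) + (1 + b^2 - a^2); the three terms of the
    value are the Poisson integrals at b1 + i a1 of 1, 2 b (x - b) / q and (1 + b^2 - a^2) / q. The
    factor |z1 - z|^2 has cancelled, so a single formula covers coinciding quadratics too. *)
Lemma integral_div_cauchy_denM a1 b1 a b : 0 < a1 -> 0 < a ->
  (\int[@lebesgue_measure R]_x
     ((1 + x ^+ 2) / (cauchy_den a1 b1 x * cauchy_den a b x))%:E =
   (pi / a1 * (1 + (2 * b * (b1 - b) + (1 + b ^+ 2 - a ^+ 2) * (a + a1) / a) /
                ((b1 - b) ^+ 2 + (a1 + a) ^+ 2)))%:E)%E.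
Proof.
move=> a10 a0.
have [|] := eqVneq ((b1 - b) ^+ 2 + (a1 - a) ^+ 2) 0; last first.
  exact: integral_partial_fractions_neq.
move=> /eqP; rewrite paddr_eq0 ?sqr_ge0// !sqrf_eq0 !subr_eq0.
move=> /andP[/eqP -> /eqP ->].
rewrite integral_partial_fractions_eq//; congr EFin.
by field; rewrite gt_eqF ?gt_eqF// ltr_wpDl ?sqr_ge0// exprn_gt0// addr_gt0.
Qed.

End cauchy_den_integral.

(** * Translations of Lebesgue measure and periodic sets *)

Section lebesgue_shift.
Context {R : realType}.
Local Notation mu := (@lebesgue_measure R).

Lemma lebesgue_measure_shift (a : R) (A : set R) : measurable A ->
  mu [set x | A (x + a)] = mu A.
Proof.
move=> mA; apply/esym.
have ma : measurable_fun [set: measurableTypeR R]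
    ((fun x => x + a) : measurableTypeR R -> measurableTypeR R).
  exact: measurable_funD.
rewrite -[RHS]/(pushforward mu ((fun x => x + a) : _ -> measurableTypeR R) A).
apply: lebesgue_measure_unique => //= _ [[c e]] _ <-.
rewrite /pushforward/=.
have -> : +%R^~ a @^-1` `]c, e] = `]c - a, e - a]%classic.
  by apply/seteqP; split => x /=; rewrite !in_itv/= ltrBlDr lerBrDr.
by rewrite !lebesgue_measure_itv/= !lte_fin ltrD2r -!EFinB opprB addrA subrK.
Qed.

Lemma lebesgue_measure_itv_oc (E : set R) (c e : R) : measurable E -> c < e ->
  mu (E `&` `]c, e]) = mu (E `&` `]c, e[).
Proof.
move=> mE ce; rewrite -(@setUitv1 _ _ (BRight c) e true)// setIUr.
rewrite measureU0//; [exact: measurableI|exact: measurableI|].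
apply: (subset_measure0 _ _ (@subIsetr _ _ _)) => //.
- exact: measurableI.
- exact: lebesgue_measure_set1.
Qed.

(** The two windows share []c', c + T]]; what remains of the first, []c, c']], is carried by the
    period onto what remains of the second. Half-open intervals make these pieces disjoint. *)
Lemma lebesgue_measure_periodic (E : set R) (T c c' : R) : measurable E ->
  (forall x, E (x + T) <-> E x) -> c <= c' <= c + T ->
  mu (E `&` `]c, c + T]) = mu (E `&` `]c', c' + T]).
Proof.
move=> mE ET /andP[cc' c'T].
have c'cT : c + T <= c' + T by rewrite lerD2r.
rewrite (@itv_bndbnd_setU _ _ (BRight c) (BRight c')) ?bnd_simp//.
rewrite (@itv_bndbnd_setU _ _ (BRight c') (BRight (c + T)) (BRight (c' + T)))
  ?bnd_simp//.
have dis (u v w : R) : (E `&` `]u, v]) `&` (E `&` `]v, w]) = set0.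
  rewrite -subset0 => x [[_ /=]]; rewrite in_itv/= => /andP[_ xv] [_].
  by rewrite /= in_itv/= ltNge xv.
have mI (u v : R) : measurable (E `&` `]u, v]) by exact: measurableI.
rewrite !setIUr !measureU//; [|exact: mI..].
rewrite [in LHS]addeC; congr (_ + _)%E.
transitivity (mu [set x | (E `&` `]c + T, c' + T]) (x + T)]); last first.
  exact: lebesgue_measure_shift.
congr mu; apply/seteqP; split => x /=;
  by rewrite !in_itv/= ltrD2r lerD2r => -[/ET Ex ->].
Qed.

End lebesgue_shift.

(** * The measure dx / (1 + x^2) and its rotations *)

Section arctan_measure.
Context {R : realType}.
Local Notation mu := (@lebesgue_measure R).

Lemma measurable_tan : measurable_fun [set: R] (@tan R).
Proof.
apply: measurable_funM.
  by apply: continuous_measurable_fun; exact: continuous_sin.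
apply: measurable_funVr.
by apply: continuous_measurable_fun; exact: continuous_cos.
Qed.

Let I : set R := `](- (pi / 2)), (pi / 2)[.

Let mI : measurable I. Proof. exact: measurable_itv. Qed.

Let mtan : measurable_fun [set: measurableTypeR R]
  (tan : measurableTypeR R -> measurableTypeR R).
Proof. exact: measurable_tan. Qed.

(* The law, scaled by pi, of the tangent of a uniform angle, i.e., the measure
   dx / (1 + x^2). The endpoints are excluded since [tan (pi / 2)] is the junk
   value 0. *)
Definition arctan_measure : set (measurableTypeR R) -> \bar R :=
  pushforward (mrestr mu mI) (tan : measurableTypeR R -> measurableTypeR R).

Let arctan0 : arctan_measure set0 = 0%E.
Proof. by rewrite /arctan_measure /pushforward preimage_set0 measure0. Qed.

Let arctan_ge0 A : (0 <= arctan_measure A)%E.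
Proof. exact: measure_ge0. Qed.

Let arctan_sigma_additive : semi_sigma_additive arctan_measure.
Proof.
exact: (measure_semi_sigma_additive (s := pushforward (mrestr mu mI)
  (tan : measurableTypeR R -> measurableTypeR R))).
Qed.

HB.instance Definition _ := isMeasure.Build _ _ _ arctan_measure
  arctan0 arctan_ge0 arctan_sigma_additive.

Lemma arctan_measureE A : arctan_measure A = mu (tan @^-1` A `&` I).
Proof. by []. Qed.

End arctan_measure.

Section arctan_measure_theory.
Context {R : realType}.
Local Notation mu := (@lebesgue_measure R).
Local Notation nu := (@arctan_measure R).

Let I : set R := `](- (pi / 2)), (pi / 2)[.

Let mI : measurable I. Proof. exact: measurable_itv. Qed.

Let w (x : R) : R := 1 + x ^+ 2.

Let mw : measurable_fun [set: measurableTypeR R] (EFin \o w).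
Proof.
by apply/measurable_EFinP; apply: measurable_funD => //; exact: measurable_funX.
Qed.

Let w_ge0 x : 0 <= w x.
Proof. by rewrite addr_ge0// sqr_ge0. Qed.

(** Made a measure so that the uniqueness of Lebesgue measure can identify it from its values on
    intervals. *)
Let wnu (A : set (measurableTypeR R)) := (\int[nu]_(x in A) (w x)%:E)%E.

Let wnu0 : wnu set0 = 0%E. Proof. by rewrite /wnu integral_set0. Qed.

Let wnu_ge0 A : (0 <= wnu A)%E.
Proof. by apply: integral_ge0 => x _; rewrite lee_fin. Qed.

Let wnu_sigma_additive : semi_sigma_additive wnu.
Proof. by apply: semi_sigma_additive_nng_induced => // x; rewrite lee_fin. Qed.

HB.instance Definition _ := isMeasure.Build _ _ _ wnu
  wnu0 wnu_ge0 wnu_sigma_additive.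

Let cos_gt0_I (x : R) : I x -> 0 < cos x.
Proof. by rewrite /I/= in_itv/= => xI; exact: cos_gt0_pihalf. Qed.

(** On []a, b]] the right-hand side is the integral of 1 + tan^2, the derivative of tan, from
    [atan a] to [atan b]. *)
Lemma lebesgue_measure_arctan (A : set R) : measurable A ->
  mu A = (\int[nu]_(x in A) (1 + x ^+ 2)%:E)%E.
Proof.
apply: (lebesgue_measure_unique (mu := wnu)) => _ [[a b]] _ <- /=.
rewrite lebesgue_measure_itv/= lte_fin.
have [ab|ba] := ltP a b; last by rewrite set_itv_ge ?wnu0 ?bnd_simp// -leNgt.
have mtan : measurable_fun [set: measurableTypeR R]
    (tan : measurableTypeR R -> measurableTypeR R) by exact: measurable_tan.
rewrite /wnu /arctan_measure ge0_integral_pushforward//=; last 2 first.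
- exact: measurable_funTS.
- by move=> x _; rewrite lee_fin.
have mtanab : measurable (tan @^-1` `]a, b]%classic : set (measurableTypeR R)).
  by rewrite -[X in measurable X]setTI; exact: mtan.
have mwtan : measurable_fun [set: measurableTypeR R] (fun x => (w (tan x))%:E).
  exact: measurableT_comp mw mtan.
transitivity (\int[mrestr mu mI]_(x in (tan @^-1` `]a, b] :
    set (measurableTypeR R))) (w (tan x))%:E)%E; last by [].
(* The preimage of []a, b]] under tan repeats with period pi; discarding the complement of [I], null
   for the restricted measure, leaves one branch, where tan increases. *)
rewrite (@ge0_negligible_integral _ _ _ (mrestr mu mI) _ (~` I))//=;
  last 4 first.
- exact: measurableC.
- exact: measurable_funTS.
- by move=> x _; rewrite lee_fin.
- by rewrite /mrestr setICl measure0.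
have -> : (tan @^-1` `]a, b] `\` ~` I)%classic = `]atan a, atan b]%classic.
  apply/seteqP; split => x /=.
    move=> [+ /contrapT Ix]; rewrite !in_itv/= => /andP[ax xb].
    rewrite -(tanK Ix) lt_atan//=; exact: le_atan.
  rewrite !in_itv/= => /andP[ax xb].
  have Ix : x \in `](- (pi / 2)), (pi / 2)[.
    rewrite in_itv/= (lt_trans (atan_gtNpi2 a) ax)/=.
    exact: le_lt_trans xb (atan_ltpi2 b).
  split; last by apply.
  have Ia (t : R) : atan t \in `](- (pi / 2)), (pi / 2)[.
    by rewrite in_itv/= atan_gtNpi2 atan_ltpi2.
  have -> : a < tan x by rewrite -[a]atanK (ltr_tan (Ia a) Ix).
  by rewrite /= leNgt -[b]atanK (ltr_tan (Ia b) Ix) -leNgt.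
have subI : `]atan a, atan b] `<=` I.
  move=> x; rewrite /I/= !in_itv/= => /andP[ax xb].
  rewrite (lt_trans (atan_gtNpi2 a) ax)/=.
  exact: le_lt_trans xb (atan_ltpi2 b).
rewrite (eq_measure_integral mu); last first.
  by move=> B mB /subset_trans/(_ subI) BI; rewrite /= /mrestr setIidl.
rewrite integral_itv_obnd_cbnd; last exact: measurable_funTS.
have subIcc : `[atan a, atan b] `<=` I.
  move=> x; rewrite /I/= !in_itv/= => /andP[ax xb].
  rewrite (lt_le_trans (atan_gtNpi2 a) ax)/=.
  exact: le_lt_trans xb (atan_ltpi2 b).
have cneq0 x : x \in `[atan a, atan b] -> cos x != 0.
  by move=> xab; rewrite gt_eqF// cos_gt0_I//; exact: subIcc.
have ctan x : x \in `[atan a, atan b] -> {for x, continuous (@tan R)}.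
  by move=> /cneq0; exact: continuous_tan.
have aab : atan a \in `[atan a, atan b] by rewrite in_itv/= lexx ltW ?lt_atan.
have bab : atan b \in `[atan a, atan b] by rewrite in_itv/= lexx ltW ?lt_atan.
rewrite (@continuous_FTC2 _ (w \o tan) tan).
- by rewrite !atanK.
- exact: lt_atan.
- apply: continuous_in_subspaceT => x; rewrite inE => xab.
  apply: continuous_comp; first exact: ctan.
  by apply/differentiable_continuous/derivable1_diffP; exact: ex_derive.
- split.
  + move=> x xab; apply: derivable_tan; apply: cneq0.
    exact: subset_itv_oo_cc xab.
  + by apply: cvg_at_right_filter; exact: ctan.
  + by apply: cvg_at_left_filter; exact: ctan.
- move=> x xab.
  have cx : cos x != 0 by apply: cneq0; exact: subset_itv_oo_cc xab.
  have dt := is_derive_tan cx.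
  by rewrite derive1E derive_val cos2_tan2.
Qed.

Lemma arctan_measure_set1 (c : R) : nu [set c] = 0%E.
Proof.
have sub : tan @^-1` [set c] `&` I `<=` [set atan c].
  by move=> t [/= <- /tanK].
rewrite arctan_measureE; apply/eqP.
rewrite -measure_le0 -(lebesgue_measure_set1 (atan c)).
apply: le_measure => //; rewrite inE//; apply: measurableI => //.
rewrite -[X in measurable X]setTI.
by have := @measurable_tan R; apply.
Qed.

(* With x = tan al, the map y |-> (x + y) / (1 - x y) is the rotation
   t |-> t + al read through tan; where 1 - x y = 0 both sides are the junk
   value 0. *)
Lemma arctan_measure_rot (x : R) (A : set R) : measurable A ->
  nu [set y | A ((x + y) / (1 - x * y))] = nu A.
Proof.
move=> mA; pose E := tan @^-1` A.
have mE : measurable (E : set R).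
  by rewrite /E -[X in measurable X]setTI; exact: (@measurable_tan R).
have EP t : E (t + pi) <-> E t by rewrite /E/= tanDpi.
set al := atan x.
have al_lt : - (pi / 2) < al < pi / 2 by rewrite atan_gtNpi2 atan_ltpi2.
have cal : cos al != 0 by rewrite gt_eqF// cos_gt0_pihalf.
rewrite !arctan_measureE.
(* By the addition formula the left side measures the t in [I] with [t + al] in [E], hence the
   window moved by [al]. As [E] has period pi, windows of length pi all have the same measure. *)
transitivity (mu (E `&` `]al - pi / 2, al + pi / 2[)).
  transitivity (mu [set t | (E `&` `]al - pi / 2, al + pi / 2[) (t + al)]);
    last by apply: lebesgue_measure_shift; exact: measurableI.
  congr mu; apply/seteqP; split => t /=; rewrite !in_itv/= => -[+ tI].
    have ct : cos t != 0 by rewrite gt_eqF// cos_gt0_pihalf.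
    rewrite -[x]atanK -tanD// addrC => At; split => //.
    by move: tI; rewrite addrC -ltrBlDl; lra.
  have tI' : - (pi / 2) < t < pi / 2 by lra.
  have ct : cos t != 0 by rewrite gt_eqF// cos_gt0_pihalf.
  by rewrite /E/= addrC tanD// atanK.
have pi0 := pi_gt0 R.
rewrite -[RHS]lebesgue_measure_itv_oc//; last lra.
rewrite -[LHS]lebesgue_measure_itv_oc//; last lra.
have hc : - (pi / 2) + pi = pi / 2 :> R by lra.
have hc' : al - pi / 2 + pi = al + pi / 2 by lra.
(* The sign of [al] decides which of the two windows lies to the left. *)
have := lebesgue_measure_periodic mE EP (c := - (pi / 2)) (c' := al - pi / 2).
have := lebesgue_measure_periodic mE EP (c' := - (pi / 2)) (c := al - pi / 2).
rewrite hc hc'; have [al0|al0] := leP 0 al.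
  by move=> _ -> //; lra.
by move=> -> //; lra.
Qed.
End arctan_measure_theory.

(** * The conditional density of U and its integral against the density of [C1] *)

Section tan_add_kernel.
Context {R : realType}.
Implicit Types a b x u y : R.

(* [tan_add_den a b x u] = |u - x - z (1 + u x)|^2 with z = b + i a. The kernel
   is the density at u of (x + C) / (1 - x C), for C of scale a and
   location b. *)
Definition tan_add_den a b x u : R :=
  (u - x - b * (1 + u * x)) ^+ 2 + (a * (1 + u * x)) ^+ 2.

Definition tan_add_kernel a b x u : R :=
  pi^-1 * (a * (1 + x ^+ 2) / tan_add_den a b x u).

Let sqr1_gt0 x : 0 < 1 + x ^+ 2.
Proof. by rewrite ltr_wpDr ?sqr_ge0. Qed.

(** If both squares vanished, then 1 + u x = 0 and so u = x, giving 1 + x^2 = 0. *)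
Lemma tan_add_den_gt0 a b x u : 0 < a -> 0 < tan_add_den a b x u.
Proof.
move=> a0; rewrite lt_neqAle addr_ge0 ?sqr_ge0// andbT eq_sym.
apply/negP; rewrite paddr_eq0 ?sqr_ge0// !sqrf_eq0 mulf_eq0 (gt_eqF a0)/=.
move=> /andP[+ /eqP ux]; rewrite ux mulr0 subr0 subr_eq0 => /eqP ue.
by have := sqr1_gt0 x; rewrite expr2 -[X in 1 + X * _]ue ux ltxx.
Qed.

Lemma tan_add_kernel_ge0 a b x u : 0 < a -> 0 <= tan_add_kernel a b x u.
Proof.
move=> a0; rewrite mulr_ge0 ?invr_ge0 ?pi_ge0// divr_ge0//.
  by rewrite mulr_ge0 ?ltW.
exact/ltW/tan_add_den_gt0.
Qed.

Lemma cauchy_pdf_ge0 a b x : 0 < a -> 0 <= cauchy_pdf a b x.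
Proof.
move=> a0; rewrite mulr_ge0 ?invr_ge0 ?pi_ge0// divr_ge0 ?ltW//.
exact: (cauchy_den_gt0 b x a0).
Qed.

(** Both sides are densities relative to dx / (1 + x^2); since the rotation preserves that measure,
    no Jacobian appears. *)
Lemma cauchy_pdf_tan_add a b x y : 0 < a -> 1 - x * y != 0 ->
  cauchy_pdf a b y * (1 + y ^+ 2) =
  tan_add_kernel a b x ((x + y) / (1 - x * y)) *
    (1 + ((x + y) / (1 - x * y)) ^+ 2).
Proof.
move=> a0 xy.
have D0 := tan_add_den_gt0 b x ((x + y) / (1 - x * y)) a0.
have q0 := cauchy_den_gt0 b y a0.
have x0 := sqr1_gt0 x.
(* For u = (x + y) / (1 - x y), u - x = y (1 + x^2) / (1 - x y) and 1 + u x = (1 + x^2) / (1 - x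
   y). *)
have De : tan_add_den a b x ((x + y) / (1 - x * y)) =
    (1 + x ^+ 2) ^+ 2 * cauchy_den a b y / (1 - x * y) ^+ 2.
  by rewrite /tan_add_den /cauchy_den; field.
rewrite /cauchy_pdf /tan_add_kernel -/(cauchy_den a b y) De.
have := pi_gt0 R; move: (pi : R) => P P0.
by field; rewrite xy !gt_eqF.
Qed.

(** The products b1 b2 cancel, leaving only terms of known sign. *)
Lemma tan_add_scale_gt0 a1 b1 a2 b2 : 0 < a1 -> 0 < a2 ->
  0 < (a1 + a2) * (1 + a1 * a2 - b1 * b2) + (b1 + b2) * (a1 * b2 + a2 * b1).
Proof.
move=> a10 a20.
have -> : (a1 + a2) * (1 + a1 * a2 - b1 * b2) +
    (b1 + b2) * (a1 * b2 + a2 * b1) =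
    (a1 + a2) * (1 + a1 * a2) + (a2 * b1 ^+ 2 + a1 * b2 ^+ 2) by ring.
rewrite ltr_wpDr//; first by rewrite addr_ge0// mulr_ge0 ?sqr_ge0 ?ltW.
by rewrite mulr_gt0 ?addr_gt0 ?mulr_gt0.
Qed.

(** This is |1 - z1 z2|^2 with zi = bi + i ai. Were both squares zero, the positive quantity of
    [tan_add_scale_gt0], linear in their bases, would be zero. *)
Lemma tan_add_norm_gt0 a1 b1 a2 b2 : 0 < a1 -> 0 < a2 ->
  0 < (1 + a1 * a2 - b1 * b2) ^+ 2 + (a1 * b2 + a2 * b1) ^+ 2.
Proof.
move=> a10 a20; have := tan_add_scale_gt0 b1 b2 a10 a20.
rewrite [in X in _ -> X]lt_neqAle addr_ge0 ?sqr_ge0// andbT eq_sym.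
apply: contraTneq => /eqP; rewrite paddr_eq0 ?sqr_ge0// !sqrf_eq0.
by move=> /andP[/eqP -> /eqP ->]; rewrite !mulr0 addr0 ltxx.
Qed.

Lemma integral_tan_add_kernel a1 b1 a2 b2 u : 0 < a1 -> 0 < a2 ->
  let p := 1 + a1 * a2 - b1 * b2 in let q := a1 * b2 + a2 * b1 in
  (\int[@lebesgue_measure R]_x
     (tan_add_kernel a2 b2 x u * cauchy_pdf a1 b1 x)%:E =
   (cauchy_pdf (((a1 + a2) * p + (b1 + b2) * q) / (p ^+ 2 + q ^+ 2))
      (- (((a1 + a2) * q - (b1 + b2) * p) / (p ^+ 2 + q ^+ 2))) u)%:E)%E.
Proof.
move=> a10 a20 p q.
have Na0 : 0 < (a1 + a2) * p + (b1 + b2) * q by exact: tan_add_scale_gt0.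
have E0 : 0 < p ^+ 2 + q ^+ 2 by exact: tan_add_norm_gt0.
(* As a function of x, the kernel's denominator has leading coefficient
   L = |1 + z2 u|^2 and roots b +- i a, where b - i a = (u - z2) / (1 + z2 u);
   finally M = |u (1 - z1 z2) - (z1 + z2)|^2. *)
pose L := (1 + b2 * u) ^+ 2 + (a2 * u) ^+ 2.
have L0 : 0 < L.
  rewrite lt_neqAle addr_ge0 ?sqr_ge0// andbT eq_sym.
  apply/negP; rewrite paddr_eq0 ?sqr_ge0// !sqrf_eq0 mulf_eq0 (gt_eqF a20)/=.
  by move=> /andP[+ /eqP u0]; rewrite u0 mulr0 addr0 oner_eq0.
pose a := a2 * (1 + u ^+ 2) / L.
pose b := ((u - b2) * (1 + b2 * u) - a2 ^+ 2 * u) / L.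
have a0 : 0 < a by rewrite divr_gt0// mulr_gt0.
pose M := (u * p - (b1 + b2)) ^+ 2 + (u * q + (a1 + a2)) ^+ 2.
have DE x : tan_add_den a2 b2 x u = L * cauchy_den a b x.
  rewrite /tan_add_den /cauchy_den /a /b; move: L0; rewrite /L => L0.
  by field; rewrite gt_eqF.
have ME : (b1 - b) ^+ 2 + (a1 + a) ^+ 2 = M / L.
  rewrite /M /p /q /a /b; move: L0; rewrite /L => L0.
  by field; rewrite gt_eqF.
have M0 : 0 < M.
  have : 0 < M / L by rewrite -ME ltr_wpDl ?sqr_ge0// exprn_gt0// addr_gt0.
  by rewrite pmulr_lgt0// invr_gt0.
transitivity (\int[@lebesgue_measure R]_x ((a1 * a2 / (pi ^+ 2 * L))%:E *
   ((1 + x ^+ 2) / (cauchy_den a1 b1 x * cauchy_den a b x))%:E))%E.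
  apply: eq_integral => x _; rewrite -EFinM; congr EFin.
  rewrite /tan_add_kernel DE /cauchy_pdf -/(cauchy_den a1 b1 x).
  have := cauchy_den_gt0 b1 x a10; have := cauchy_den_gt0 b x a0.
  move: (cauchy_den a b x) (cauchy_den a1 b1 x) => r r1 r0 r10.
  have := pi_gt0 R; move: (pi : R) => P P0.
  by field; rewrite !gt_eqF.
rewrite ge0_integralZl//; last 3 first.
- apply/measurable_EFinP; apply: measurable_funM.
    by apply: measurable_funD => //; exact: measurable_funX.
  apply: measurable_funVr; apply: measurable_funM;
    by apply: continuous_measurable_fun; exact: continuous_cauchy_den.
- move=> x _; rewrite lee_fin divr_ge0 ?(ltW (sqr1_gt0 x))// mulr_ge0//;
    by rewrite ltW ?cauchy_den_gt0.
- rewrite lee_fin ltW// divr_gt0//; first exact: mulr_gt0.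
  by rewrite mulr_gt0// exprn_gt0// pi_gt0.
rewrite integral_div_cauchy_denM// ME -EFinM; congr EFin.
rewrite /cauchy_pdf.
(* Dividing [M] by |1 - z1 z2|^2 gives |u - (z1 + z2) / (1 - z1 z2)|^2: the new location and scale
   are the real and imaginary parts of this quotient. *)
have -> : (u - - (((a1 + a2) * q - (b1 + b2) * p) / (p ^+ 2 + q ^+ 2))) ^+ 2 +
    (((a1 + a2) * p + (b1 + b2) * q) / (p ^+ 2 + q ^+ 2)) ^+ 2 =
    M / (p ^+ 2 + q ^+ 2).
  by rewrite /M; field; rewrite gt_eqF.
have -> :
   1 + (2 * b * (b1 - b) + (1 + b ^+ 2 - a ^+ 2) * (a + a1) / a) / (M / L)
   = L * ((a1 + a2) * p + (b1 + b2) * q) / (a2 * M).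
  have u0 := sqr1_gt0 u.
  (* The dependence on [u] cancels here, leaving the numerator of the new scale over [a2]. *)
  have Me : M / L + (2 * b * (b1 - b) + (1 + b ^+ 2 - a ^+ 2) * (a + a1) / a) =
      ((a1 + a2) * p + (b1 + b2) * q) / a2.
    rewrite /M /p /q /a /b; move: L0; rewrite /L => L0.
    by field; rewrite !gt_eqF.
  have -> : 2 * b * (b1 - b) + (1 + b ^+ 2 - a ^+ 2) * (a + a1) / a =
      ((a1 + a2) * p + (b1 + b2) * q) / a2 - M / L.
    by rewrite -Me [RHS]addrAC subrr add0r.
  by field; rewrite !gt_eqF.
have := pi_gt0 R; move: (pi : R) => P P0.
by field; rewrite !gt_eqF.
Qed.
End tan_add_kernel.

(** * The law of (x + C) / (1 - x C) for fixed x *)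

Lemma measurable_fun_tan_add d (T : measurableType d) (R : realType)
    (f g : T -> R) :
  measurable_fun [set: T] f -> measurable_fun [set: T] g ->
  measurable_fun [set: T] (fun x => (f x + g x) / (1 - f x * g x)).
Proof.
move=> mf mg; apply: measurable_funM; first exact: measurable_funD.
apply: measurable_funVr; apply: measurable_funB => //.
exact: measurable_funM.
Qed.

Section cauchy_tan_add.
Context {R : realType}.
Local Notation mu := (@lebesgue_measure R).
Local Notation nu := (@arctan_measure R).
Implicit Types a b x u y : R.

Lemma measurable_tan_add x :
  measurable_fun [set: R] (fun y => (x + y) / (1 - x * y)).
Proof.
apply: (measurable_fun_tan_add (f := cst x) (g := idfun)).
  exact: measurable_cst.
exact: measurable_id.
Qed.

Lemma measurable_cauchy_pdf a b : measurable_fun [set: R] (cauchy_pdf a b).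
Proof.
apply: measurable_funM => //; apply: measurable_funM => //.
apply: measurable_funVr; apply: measurable_funD => //.
by apply: measurable_funX; exact: measurable_funB.
Qed.

Lemma measurable_tan_add_kernel a b :
  measurable_fun [set: R * R] (fun p => tan_add_kernel a b p.1 p.2).
Proof.
have m1 : measurable_fun [set: R * R] (fun p => p.1) by exact: measurable_fst.
have m2 : measurable_fun [set: R * R] (fun p => p.2) by exact: measurable_snd.
apply: measurable_funM => //; apply: measurable_funM.
  apply: measurable_funM => //; apply: measurable_funD => //.
  exact: measurable_funX.
apply: measurable_funVr; apply: measurable_funD; apply: measurable_funX.
  apply: measurable_funB; first exact: measurable_funB.
  apply: measurable_funM => //; apply: measurable_funD => //.
  exact: measurable_funM.
apply: measurable_funM => //; apply: measurable_funD => //.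
exact: measurable_funM.
Qed.

Lemma measurable_tan_add_kernel_snd a b x :
  measurable_fun [set: R] (tan_add_kernel a b x).
Proof.
exact: measurableT_comp (measurable_tan_add_kernel a b) (measurable_pair1 x).
Qed.

Lemma integral_arctan_measure (f : R -> \bar R) :
  measurable_fun [set: R] f -> (forall x, 0 <= f x)%E ->
  (\int[mu]_x f x = \int[nu]_x (f x * (1 + x ^+ 2)%:E))%E.
Proof.
move=> mf f0; apply: (@ge0_integral_density _ (measurableTypeR R)) => //.
- by apply: measurable_funD => //; exact: measurable_funX.
- by move=> x; rewrite addr_ge0// sqr_ge0.
- exact: lebesgue_measure_arctan.
Qed.

Lemma integral_arctan_rot x (f : R -> \bar R) :
  measurable_fun [set: R] f -> (forall x, 0 <= f x)%E ->
  (\int[nu]_y f ((x + y) / (1 - x * y))%R = \int[nu]_y f y)%E.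
Proof.
move=> mf f0.
pose T : measurableTypeR R -> measurableTypeR R :=
  fun y => (x + y) / (1 - x * y).
have mT : measurable_fun [set: measurableTypeR R] T.
  exact: measurable_tan_add.
transitivity (\int[pushforward nu T]_y f y)%E.
  by apply/esym; apply: (ge0_integral_pushforward mT nu measurableT mf).
apply: eq_measure_integral => A mA _; exact: arctan_measure_rot.
Qed.

Lemma integral_cauchy_pdf_tan_add a b x (A : set R) : 0 < a -> measurable A ->
  (\int[mu]_(y in [set y | A ((x + y) / (1 - x * y))%R]) (cauchy_pdf a b y)%:E =
   \int[mu]_(u in A) (tan_add_kernel a b x u)%:E)%E.
Proof.
move=> a0 mA; pose T y := (x + y) / (1 - x * y).
pose B := [set y | A (T y)].
have mB : measurable B.
  rewrite -[X in measurable X]setTI.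
  exact: (measurable_tan_add x measurableT mA).
have mw : measurable_fun [set: R] (fun u => (1 + u ^+ 2)%:E).
  by apply/measurable_EFinP; exact: measurable_funD.
have mf : measurable_fun [set: R] ((EFin \o cauchy_pdf a b) \_ B).
  apply/(measurable_restrict _ mB measurableT); rewrite setTI.
  apply: measurable_funTS; apply/measurable_EFinP.
  exact: measurable_cauchy_pdf.
have mg : measurable_fun [set: R] ((EFin \o tan_add_kernel a b x) \_ A).
  apply/(measurable_restrict _ mA measurableT); rewrite setTI.
  apply: measurable_funTS; apply/measurable_EFinP.
  exact: measurable_tan_add_kernel_snd.
have f0 y : (0 <= ((EFin \o cauchy_pdf a b) \_ B) y)%E.
  by apply: erestrict_ge0 => z _; rewrite lee_fin cauchy_pdf_ge0.
have g0 y : (0 <= ((EFin \o tan_add_kernel a b x) \_ A) y)%E.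
  by apply: erestrict_ge0 => z _; rewrite lee_fin tan_add_kernel_ge0.
have w0 y : (0 <= (1 + y ^+ 2)%:E :> \bar R)%E.
  by rewrite lee_fin addr_ge0 ?sqr_ge0.
rewrite integral_mkcond [RHS]integral_mkcond.
rewrite integral_arctan_measure// [RHS]integral_arctan_measure//.
(* With both integrals taken against [nu], rotating the right one makes the integrands comparable at
   the same [y]. *)
rewrite -[RHS](integral_arctan_rot x); last 2 first.
- exact: emeasurable_funM.
- by move=> y; rewrite mule_ge0.
rewrite (@ge0_negligible_integral _ _ _ nu _ [set x^-1])//; last 3 first.
- exact: emeasurable_funM.
- by move=> y _; rewrite mule_ge0.
- exact: arctan_measure_set1.
rewrite [RHS](@ge0_negligible_integral _ _ _ nu _ [set x^-1])//; last 3 first.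
- apply: (measurableT_comp (f := fun u =>
      (((EFin \o tan_add_kernel a b x) \_ A) u * (1 + u ^+ 2)%:E)%E)).
    exact: emeasurable_funM.
  exact: measurable_tan_add.
- by move=> y _; rewrite mule_ge0.
- exact: arctan_measure_set1.
apply: eq_integral => y; rewrite inE => -[_ /= yx].
have xy0 : 1 - x * y != 0.
  apply/eqP => /eqP; rewrite subr_eq0 => /eqP xy; apply: yx.
  have x0 : x != 0 by apply: contra_eq_neq xy => ->; rewrite mul0r oner_eq0.
  by apply: (mulfI x0); rewrite divff.
rewrite !patchE (_ : (y \in B) = (T y \in A))// /T.
case: ifP => _; last by rewrite !mul0e.
by rewrite /= -!EFinM (cauchy_pdf_tan_add b a0 xy0).
Qed.

End cauchy_tan_add.

(** * Independence, Tonelli and the law of U *)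

Lemma independent_RV2_product d (T : measurableType d) (R : realType)
    (P : probability T R) (X Y : {RV P >-> R}) (S : set (R * R)) :
  independent_RV2 X Y -> measurable S ->
  P [set w | S (X w, Y w)] =
  (\int[P]_w distribution P Y (xsection S (X w)))%E.
Proof.
move=> ind mS.
pose XY w := (X w, Y w).
have mXY : measurable_fun [set: T] XY by exact: measurable_fun_pair.
(* Independence says that the joint law agrees with the product of the marginals on rectangles,
   hence on every measurable set. *)
have := @product_measure_unique _ _ _ _ _ (distribution P X) (distribution P Y)
  (pushforward P XY) => H.
rewrite -[LHS]/(pushforward P XY S) -H// /product_measure1.
rewrite (ge0_integral_distribution X (f := distribution P Y \o xsection S))//.
exact: measurable_fun_xsection.
Qed.

(* The location is (z1 + z2) / (1 - z1 z2) read at the real part, with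
   zi = bi + i ai; the source prints it with the opposite sign, which already
   fails in the limit a2 -> 0, b2 = 0, where U -> C1. *)
Theorem theorem3p1 (d : measure_display) (T : measurableType d) (R : realType)
    (P : probability T R) (C1 C2 : {RV P >-> R}) (a1 b1 a2 b2 : R)
    (hC1 : cauchy_distributed P C1 a1 b1)
    (hC2 : cauchy_distributed P C2 a2 b2)
    (hind : independent_RV2 C1 C2) :
  cauchy_distributed P
    (fun w : T => (C1 w + C2 w) / (1 - C1 w * C2 w))
    (((a1 + a2) * (1 + a1 * a2 - b1 * b2)
        + (b1 + b2) * (a1 * b2 + a2 * b1))
      / ((1 + a1 * a2 - b1 * b2) ^+ 2 + (a1 * b2 + a2 * b1) ^+ 2))
    (- (((a1 + a2) * (a1 * b2 + a2 * b1)
          - (b1 + b2) * (1 + a1 * a2 - b1 * b2))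
        / ((1 + a1 * a2 - b1 * b2) ^+ 2 + (a1 * b2 + a2 * b1) ^+ 2))).
Proof.
case: hC1 => a10 _ C1E; case: hC2 => a20 _ C2E.
have E0 := tan_add_norm_gt0 b1 b2 a10 a20.
split.
- by rewrite divr_gt0// tan_add_scale_gt0.
- exact: measurable_fun_tan_add.
move=> A mA.
pose S := [set p : R * R | A ((p.1 + p.2) / (1 - p.1 * p.2))].
have mS : measurable S.
  have m1 : measurable_fun [set: R * R] fst by exact: measurable_fst.
  have m2 : measurable_fun [set: R * R] snd by exact: measurable_snd.
  rewrite -[X in measurable X]setTI.
  exact: (measurable_fun_tan_add m1 m2 measurableT).
rewrite /pushforward [LHS](independent_RV2_product hind mS).
pose X1 : T -> measurableTypeR R := C1.
have mX1 : measurable_fun [set: T] X1 by exact: (measurable_funPT C1).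
pose G : measurableTypeR R -> \bar R := distribution P C2 \o xsection S.
have mG : measurable_fun [set: measurableTypeR R] G.
  exact: (measurable_fun_xsection (distribution P C2) mS).
have G0 x : (0 <= G x)%E by exact: measure_ge0.
(* The expectation over [C1] becomes an integral over its law, then one against its density. *)
rewrite -[LHS](ge0_integral_pushforward mX1 P measurableT mG)//.
have dens := @ge0_integral_density _ (measurableTypeR R) R
  (@lebesgue_measure R) (pushforward P X1) (cauchy_pdf a1 b1) G.
rewrite [LHS]dens//; last 2 first.
- exact: measurable_cauchy_pdf.
- by move=> x; exact: cauchy_pdf_ge0.
pose k x u := tan_add_kernel a2 b2 x u * cauchy_pdf a1 b1 x.
have k_ge0 x u : 0 <= k x u.
  by rewrite mulr_ge0 ?tan_add_kernel_ge0 ?cauchy_pdf_ge0.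
have mk : measurable_fun [set: R * R] (fun p => k p.1 p.2).
  apply: measurable_funM; first exact: measurable_tan_add_kernel.
  by apply: measurableT_comp (measurable_cauchy_pdf a1 b1) _.
(* The indicator of [A] is put into the integrand so that both variables range over the whole line
   when the integrals are exchanged. *)
pose K (p : measurableTypeR R * measurableTypeR R) :=
  (k p.1 p.2 * \1_A p.2)%:E.
have mK : measurable_fun setT K.
  apply/measurable_EFinP; apply: measurable_funM; first exact: mk.
  exact: (measurableT_comp (measurable_indic mA)).
have K0 p : (0 <= K p)%E by rewrite lee_fin mulr_ge0.
transitivity (\int[@lebesgue_measure R]_x
    \int[@lebesgue_measure R]_u K (x, u))%E.
  apply: eq_integral => x _.
  have mSx : measurable (xsection S x : set R) by exact: measurable_xsection.
  rewrite /G/= /distribution C2E//.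
  have -> : xsection S x = [set y | A ((x + y) / (1 - x * y))].
    by apply/seteqP; split => y; rewrite /xsection/= inE.
  rewrite integral_cauchy_pdf_tan_add//.
  rewrite -ge0_integralZr//; last 3 first.
  - apply: measurable_funTS; apply/measurable_EFinP.
    exact: measurable_tan_add_kernel_snd.
  - by move=> u _; rewrite lee_fin tan_add_kernel_ge0.
  - by rewrite lee_fin cauchy_pdf_ge0.
  rewrite integral_mkcond; apply: eq_integral => u _.
  rewrite /K /k patchE indicE/=.
  by case: ifP => uA; rewrite ?mul0e ?mulr0// mulr1 EFinM.
rewrite (fubini_tonelli K)//.
rewrite [RHS]integral_mkcond; apply: eq_integral => u _.
rewrite patchE /K/= indicE; case: ifP => uA; last first.
  by under eq_integral do rewrite mulr0; rewrite integral0.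
under eq_integral do rewrite mulr1.
exact: integral_tan_add_kernel.
Qed.
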